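(* Let $\mathcal{C}$ be an ideal $2$-cover-minimal clutter over ground set $V$, let $d$ be the number of connected components of $G(\mathcal{C})$, and let $\mu$ be the rainbow covering number of $\mathcal{C}$. Then $\mathrm{core}(\mathcal{C})$ is an ideal clutter and $|\mathrm{core}(\mathcal{C})|\geq2^{(1-H(1/\mu))d}$ (where $H(1/\mu)$ is read as $0$ if $\mu=+\infty$).
   Context: A clutter over a finite ground set $V$ is a family $\mathcal{C}$ of subsets of $V$ none of which contains another. $\mathcal{C}$ is ideal if $\{x\in\mathbb{R}^V_{\geq0}:\sum_{v\in C}x_v\geq1\ \forall C\in\mathcal{C}\}$ has only integral vertices. A cover is a set $B\subseteq V$ meeting every member of $\mathcal{C}$; $\tau(\mathcal{C})$ is the minimum size of a cover. $\mathcal{C}$ is $2$-cover-minimal if $\tau(\mathcal{C})=2$ and every element of $V$ lies in a minimum cover. $\mathrm{core}(\mathcal{C})$ is the set of members of $\mathcal{C}$ intersecting every minimum cover exactly once. $G(\mathcal{C})$ is the graph on vertex set $V$ whose edges are the minimum covers of $\mathcal{C}$. A cover is rainbow if it intersects every connected component of $G(\mathcal{C})$ in at most one element; the rainbow covering number $\mu$ is the minimum size of a rainbow cover ($+\infty$ if none exists). $H$ is the binary entropy function $H(\varepsilon)=-\varepsilon\log_2\varepsilon-(1-\varepsilon)\log_2(1-\varepsilon)$ for $\varepsilon\in(0,\tfrac12]$, $H(0)=0$. *)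

(* Defs.v *)
From mathcomp Require Import all_boot all_order all_algebra.
From mathcomp Require Import reals exp.

Set Implicit Arguments.
Unset Strict Implicit.
Unset Printing Implicit Defensive.

Import Order.TTheory GRing.Theory Num.Theory.

Section Clutters.

Variable V : finType.
Implicit Types (C F : {set {set V}}) (B : {set V}).

Definition is_clutter C : Prop :=
  forall A B, A \in C -> B \in C -> A \subset B -> A = B.

Definition covers C : {set {set V}} :=
  [set B : {set V} | [forall A in C, A :&: B != set0]].

Definition min_covers C : {set {set V}} :=
  [set B in covers C | [forall B' in covers C, #|B| <= #|B'|]].

(* Smallest size of a member of F; None stands for +oo (F empty). *)
Definition min_size F : option nat :=
  if [pick B in F] is Some B0 then Some #|[arg min_(B < B0 in F) #|B|]|
  else None.

Definition tau C : option nat := min_size (covers C).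

Definition two_cover_minimal C : Prop :=
  tau C = Some 2 /\
  forall v : V, exists2 B : {set V}, B \in min_covers C & v \in B.

Definition core C : {set {set V}} :=
  [set A in C | [forall B in min_covers C, #|A :&: B| == 1]].

(* Adjacency in G(C); its edges are all the minimum covers when tau C = Some 2. *)
Definition cover_graph C : rel V :=
  fun u v => (u != v) && ([set u; v] \in min_covers C).

Definition components C : {set {set V}} :=
  equivalence_partition (connect (cover_graph C)) [set: V].

Definition rainbow_covers C : {set {set V}} :=
  [set B in covers C | [forall K in components C, #|B :&: K| <= 1]].

Definition rainbow_number C : option nat := min_size (rainbow_covers C).

End Clutters.

Local Open Scope ring_scope.

Section Ideal.

Variables (R : realType) (V : finType).
Implicit Types (P : {ffun V -> R} -> Prop) (x y z : {ffun V -> R}).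

Definition cover_polyhedron (C : {set {set V}}) x : Prop :=
  (forall v, 0 <= x v) /\
  (forall A : {set V}, A \in C -> 1 <= \sum_(v in A) x v).

(* The vertices of a polyhedron are its extreme points. *)
Definition vertex P x : Prop :=
  P x /\
  forall y z (t : R), P y -> P z -> 0 < t < 1 ->
    (forall v, x v = t * y v + (1 - t) * z v) -> y = z.

Definition ideal (C : {set {set V}}) : Prop :=
  forall x, vertex (cover_polyhedron C) x -> forall v, x v \is a Num.int.

End Ideal.

Section Entropy.

Variable R : realType.

Definition log2 (x : R) : R := ln x / ln 2.

Definition H (e : R) : R :=
  if e == 0 then 0 else - e * log2 e - (1 - e) * log2 (1 - e).

(* H(1/mu), with None standing for mu = +oo. *)
Definition H_inv (mu : option nat) : R :=
  if mu is Some m then H (1 / m%:R) else 0.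

End Entropy.

(* Main.v *)
Require Import Defs.
From mathcomp Require Import all_boot all_order all_algebra.
From mathcomp Require Import boolp reals sequences exp.
From mathcomp Require Import ring lra.

Set Implicit Arguments.
Unset Strict Implicit.
Unset Printing Implicit Defensive.

Import Order.TTheory GRing.Theory Num.Theory.
Local Open Scope ring_scope.

(* Let x >= 0 satisfy x(B) >= 1 for every cover B of C. By Farkas and the
   integrality of the vertices of the cover polyhedron, x dominates a convex
   combination of members of C; if moreover x(B) = 1 for the minimum covers B,
   complementary slackness puts that combination on the core.

   Idealness of the core: a vertex w that dominates no convex combination of covers
   of the core is separated from them by some x >= 0 with w.x < 1. Take x minimal
   with x(B) >= 1 on the covers B of the core. Every coordinate is then tight, and resolving two tight covers across an edge of G(C) shows that x is
   tight on all edges. So x dominates a convex combination of the core, and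
   w.x >= 1, a contradiction.

   Cardinality: the core is a set of points of the cube {0,1}^d (a choice of
   colour class in each component of G(C)). With e = 1/mu, every point of
   {e, 1-e}^d satisfies the rainbow cover inequalities, and these imply all the
   others, so it is a convex combination of the core. Hence every vertex of the
   cube is within Hamming distance e d of the core, and counting Hamming balls
   gives the entropy bound. *)

Lemma ex_minimizer (R : realDomainType) (I : finType) (P : pred I) (f : I -> R)
    (i0 : I) :
  P i0 -> exists2 i, P i & forall j, P j -> f i <= f j.
Proof. by move=> Pi0; case: (arg_minP f Pi0) => i; exists i. Qed.

(** * Dot products and Farkas' lemma *)

Section Dot.
Variables (R : realFieldType) (T : finType).
Implicit Types (a x y z : T -> R).

Definition dot a x : R := \sum_t a t * x t.

Lemma dotC a x : dot a x = dot x a.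
Proof. by apply: eq_bigr => t _; rewrite mulrC. Qed.

Lemma dot_linr a x y z k :
  (forall t, z t = x t + k * y t) -> dot a z = dot a x + k * dot a y.
Proof.
move=> zE; rewrite mulr_sumr -big_split; apply: eq_bigr => t _.
by rewrite zE mulrDr mulrCA.
Qed.

Lemma dot_linl a x y z k :
  (forall t, z t = x t + k * y t) -> dot z a = dot x a + k * dot y a.
Proof. by rewrite !(dotC _ a); exact: dot_linr. Qed.

Lemma dot_self_le0 x : dot x x <= 0 -> forall t, x t = 0.
Proof.
move=> le0 t.
have sq_ge0 s : true -> 0 <= x s * x s by rewrite -expr2 sqr_ge0.
have /(psumr_eq0P sq_ge0)/(_ t isT)/eqP : dot x x = 0.
  by apply/le_anti; rewrite le0 sumr_ge0.
by rewrite mulf_eq0 orbb => /eqP.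
Qed.

End Dot.

(* Bartl's proof: if the constraint [a i] is needed, a point [x] violating it
   lets one eliminate [a i] from all the other functionals. *)
Lemma farkas (R : realFieldType) (T : finType) (I : eqType) (r : seq I)
    (a : I -> T -> R) (c : T -> R) :
    uniq r ->
    (forall x, (forall i, i \in r -> dot (a i) x <= 0) -> dot c x <= 0) ->
  exists2 l : I -> R, (forall i, 0 <= l i)
    & forall t, c t = \sum_(i <- r) l i * a i t.
Proof.
elim: r a c => [|i r IH] a c.
  move=> _ hc; exists (fun=> 0) => // t.
  by rewrite big_nil; apply: dot_self_le0; apply: hc.
rewrite /= => /andP[ir ur] hc.
have sum_upd k (l b : I -> R) :
    \sum_(j <- r) (if j == i then k else l j) * b j = \sum_(j <- r) l j * b j.
  apply: eq_big_seq => j jr; case: eqP => // ji.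
  by rewrite -ji jr in ir.
have [hr|/existsNP[x]] := EM (forall x,
    (forall j, j \in r -> dot (a j) x <= 0) -> dot c x <= 0).
  have [l l0 lE] := IH a c ur hr.
  exists (fun j => if j == i then 0 else l j) => [j|t]; first by case: ifP.
  by rewrite big_cons eqxx mul0r add0r sum_upd.
move=> /not_implyP[hx /negP]; rewrite -ltNge => cx.
have ax : 0 < dot (a i) x.
  rewrite ltNge; apply/negP => ax; move: cx; rewrite ltNge => /negP; apply.
  by apply: hc => j; rewrite inE => /predU1P[->|/hx].
(* [k b] is the multiple of [a i] whose subtraction makes [elim b] vanish at [x]. *)
pose k b := dot b x / dot (a i) x.
pose elim b t := b t + (- k b) * a i t.
have [|l l0 lE] := IH (fun j => elim (a j)) (elim c) ur.
  (* [z] is the projection of [y] along [x] onto the kernel of [a i]. *)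
  move=> y hy; pose m := dot (a i) y / dot (a i) x.
  pose z t := y t + (- m) * x t.
  have dotz b : dot b z = dot (elim b) y.
    rewrite (@dot_linr _ _ _ y x z (- m)) //.
    rewrite (@dot_linl _ _ _ b (a i) (elim b) (- k b)) //.
    by rewrite /k /m; field; rewrite gt_eqF.
  rewrite -dotz; apply: hc => j; rewrite inE => /predU1P[->|/hy].
    by rewrite (@dot_linr _ _ _ y x z (- m)) // mulNr divfK ?subrr // gt_eqF.
  by rewrite dotz.
(* The multiplier of [a i] is nonnegative because [k c > 0] and [k (a j) <= 0] for [j] in [r]. *)
exists (fun j => if j == i then k c - \sum_(j <- r) l j * k (a j) else l j).
  move=> j; case: eqP => // _; rewrite subr_ge0.
  apply: (@le_trans _ _ 0); last by rewrite divr_ge0 ?ltW.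
  rewrite big_seq; apply: sumr_le0 => j' j'r.
  by rewrite mulr_ge0_le0 // /k mulr_le0_ge0 ?hx // invr_ge0 ltW.
move=> t; rewrite big_cons eqxx sum_upd.
have -> : c t = elim c t + k c * a i t by rewrite /elim mulNr subrK.
rewrite lE mulrBl mulr_suml [RHS]addrAC -addrA addrC; congr (_ + _).
rewrite -sumrN -big_split; apply: eq_bigr => j _ /=; rewrite /elim; ring.
Qed.

(** * Minimising a linear functional at a vertex *)

Section Vertices.
Variables (R : realType) (V I : finType).
Variables (a : I -> V -> R) (b : I -> R).

Definition polyhedron (w : {ffun V -> R}) : Prop :=
  forall i, b i <= dot (a i) w.

Let slack (w : {ffun V -> R}) := [set i | dot (a i) w != b i].

(* Slide along [d] until a new constraint becomes tight. *)
Lemma slide_to_tight (w : {ffun V -> R}) (d : V -> R) (j : I) :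
    polyhedron w -> (forall i, dot (a i) w = b i -> dot (a i) d = 0) ->
    dot (a j) d < 0 ->
  exists t : R, [/\ 0 <= t, polyhedron [ffun v => w v + t * d v]
                  & (#|slack [ffun v => w v + t * d v]%R| < #|slack w|)%N].
Proof.
move=> hw hd hj.
(* Ratio test: [q i] is the time at which constraint [i] becomes tight along [d]. *)
pose q i := (dot (a i) w - b i) / (- dot (a i) d).
have [i0 hi0 q_min] := @ex_minimizer _ _ (fun i => dot (a i) d < 0) q j hj.
have dotE i : dot (a i) [ffun v => w v + q i0 * d v]
    = dot (a i) w + q i0 * dot (a i) d.
  by apply: dot_linr => v; rewrite ffunE.
have qd0 : dot (a i0) w + q i0 * dot (a i0) d = b i0.
  by rewrite /q; field; rewrite lt_eqF.
have q0 : 0 <= q i0 by rewrite divr_ge0 ?subr_ge0 ?hw // oppr_ge0 ltW.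
exists (q i0); split=> // [i|].
  rewrite dotE; have [di|di] := leP 0 (dot (a i) d).
    by rewrite (le_trans (hw i)) // lerDl mulr_ge0.
  have := q_min _ di; rewrite {2}/q ler_pdivlMr ?oppr_gt0 //; lra.
apply: proper_card; apply/properP; split.
  apply/subsetP => i; rewrite !inE; apply: contra => /eqP di.
  by rewrite dotE hd // mulr0 addr0 di.
exists i0; rewrite !inE ?dotE ?qd0 ?eqxx //.
by apply/eqP => /hd d0; rewrite d0 ltxx in hi0.
Qed.

(** A point that is not a vertex is interior to a segment, and one of its two directions does not
    increase [x]. Sliding that way lowers the number of slack constraints. The first hypothesis
    makes the slide stop once the direction has a negative coordinate. *)
Lemma ex_vertex_le (x : V -> R) (w : {ffun V -> R}) :
    (forall d v, d v < 0 -> exists j, dot (a j) d < 0) ->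
    (forall v, 0 <= x v) -> polyhedron w ->
  exists2 w', vertex polyhedron w' & dot x w' <= dot x w.
Proof.
move=> pointed x0; have [n] := ubnP #|slack w|.
elim: n w => // n IH w ltn hw.
have [vw|] := EM (vertex polyhedron w); first by exists w.
move=> /not_andP[//|/existsNP[y /existsNP[z /existsNP[t]]]].
move=> /not_implyP[hy /not_implyP[hz /not_implyP[/andP[t0 t1]]]].
move=> /not_implyP[wE yz].
pose good d := forall i, dot (a i) w = b i -> dot (a i) d = 0.
have step d v : good d -> dot x d <= 0 -> d v < 0 ->
    exists2 w', vertex polyhedron w' & dot x w' <= dot x w.
  move=> gd xd /pointed[j hj]; have [s [s0 hs ls]] := slide_to_tight hw gd hj.
  have [|w' vw' le] := IH _ _ hs; first by rewrite (leq_trans ls).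
  exists w' => //; apply: le_trans le _.
  rewrite (@dot_linr _ _ _ w d _ s) => [|u]; last by rewrite ffunE.
  by rewrite gerDl mulr_ge0_le0.
pose d v := y v + (-1) * z v; pose d' v := z v + (-1) * y v.
have dE c : dot c d = dot c y + (-1) * dot c z by apply: dot_linr.
have d'E c : dot c d' = dot c z + (-1) * dot c y by apply: dot_linr.
(* As [w] is strictly between [y] and [z], a constraint tight at [w] is tight at both ends. *)
have gd i : dot (a i) w = b i -> dot (a i) y = b i /\ dot (a i) z = b i.
  have := hy i; have := hz i.
  have -> : dot (a i) w = dot (a i) z + t * dot (a i) d.
    by apply: dot_linr => v; rewrite wE /d; ring.
  rewrite dE; set p := dot _ y; set q := dot _ z => qb pb e; nra.
have {}gd' : good d' by move=> i /gd[ey ez]; rewrite d'E ey ez; ring.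
have {}gd : good d by move=> i /gd[ey ez]; rewrite dE ey ez; ring.
have neg_of_dot c : dot x c < 0 -> exists v, c v < 0.
  move=> xc; apply: contrapT => /forallNP nc.
  move: xc; rewrite ltNge => /negP; apply; apply: sumr_ge0 => v _.
  by rewrite mulr_ge0 // leNgt; apply/negP/nc.
have [lt0|gt0|eq0] := ltgtP (dot x d) 0.
- by have [v] := neg_of_dot _ lt0; apply: step => //; exact: ltW.
- have lt0 : dot x d' < 0 by rewrite d'E; rewrite dE in gt0; lra.
  by have [v] := neg_of_dot _ lt0; apply: step => //; exact: ltW.
have eq0' : dot x d' = 0 by rewrite d'E; rewrite dE in eq0; lra.
(* Both directions now preserve the objective, so the sign is chosen to give a negative
   coordinate. *)
have [v yzv] : exists v, y v != z v.
  apply: contrapT => /forallNP e; apply: yz; apply/ffunP => v.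
  by apply/eqP/negPn/negP/e.
have [ltv|gtv|e] := ltgtP (y v) (z v); last by rewrite e eqxx in yzv.
- by apply: (@step d v); rewrite ?eq0 // /d; lra.
- by apply: (@step d' v); rewrite ?eq0' // /d'; lra.
Qed.

End Vertices.

(** * Dominants, separation and blocking duality *)

Section Dominant.
Variables (R : realType) (V : finType).
Implicit Types (C F : {set {set V}}) (A B : {set V}) (x w : V -> R).

Definition ind A (v : V) : R := (v \in A)%:R.

Lemma ind_ge0 A v : 0 <= ind A v.
Proof. exact: ler0n. Qed.

Lemma dot_indl A x : dot (ind A) x = \sum_(v in A) x v.
Proof.
by rewrite [RHS]big_mkcond; apply: eq_bigr => v _; rewrite /ind mulr_natl mulrb.
Qed.

Lemma dot_ind A B : dot (ind A) (ind B) = #|A :&: B|%:R.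
Proof.
rewrite dot_indl -sum1_card natr_sum big_mkcond [RHS]big_mkcond.
by apply: eq_bigr => v _; rewrite inE /ind; do 2!case: (v \in _).
Qed.

Lemma ler_dotr x w w' :
  (forall v, 0 <= x v) -> (forall v, w v <= w' v) -> dot x w <= dot x w'.
Proof. by move=> x0 le; apply: ler_sum => v _; apply: ler_wpM2l. Qed.

(* [x] lies in the dominant of the convex hull of the members of [F]. *)
Definition dominant F x : Prop :=
  exists y : {set V} -> R, [/\ forall A, 0 <= y A, \sum_(A in F) y A = 1
    & forall v, \sum_(A in F) y A * ind A v <= x v].

Lemma dominant_dot F x (y : {set V} -> R) w :
    (forall v, 0 <= w v) -> (forall v, \sum_(A in F) y A * ind A v <= x v) ->
  \sum_(A in F) y A * dot (ind A) w <= dot w x.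
Proof.
move=> w0 le; apply: le_trans (ler_dotr w0 le).
rewrite le_eqVlt; apply/orP; left; apply/eqP.
under eq_bigr do rewrite mulr_sumr.
rewrite exchange_big; apply: eq_bigr => v _ /=; rewrite mulr_sumr.
by apply: eq_bigr => A _; rewrite mulrA mulrC.
Qed.

Lemma dominant_dot_ge F x w :
    (forall v, 0 <= w v) -> dominant F x ->
    (forall A, A \in F -> 1 <= dot (ind A) w) ->
  1 <= dot w x.
Proof.
move=> w0 [y [y0 y1 yx]] hw; apply: le_trans (dominant_dot w0 yx).
by rewrite -y1; apply: ler_sum => A AF; rewrite ler_peMr // hw.
Qed.

(** Farkas with one extra coordinate [inl tt], which records that the weights sum to 1; the
    generators [inr u] absorb the slack in the domination. The separating [z] is positive at
    [inl tt] and nonpositive elsewhere, and rescaling it gives [w]. *)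
Lemma not_dominant F x :
    (forall v, 0 <= x v) -> ~ dominant F x ->
  exists w : V -> R, [/\ forall v, 0 <= w v,
    forall A, A \in F -> 1 <= dot (ind A) w & dot w x < 1].
Proof.
move=> x0 ndom.
pose a (i : {set V} + V) (t : unit + V) : R :=
  match i, t with
  | inl A, inr v => (A \in F)%:R * ind A v
  | inl A, inl _ => (A \in F)%:R
  | inr u, inr v => (u == v)%:R
  | inr u, inl _ => 0
  end.
pose c (t : unit + V) : R := if t is inr v then x v else 1.
have dot_opt (p q : unit + V -> R) : dot p q =
    p (inl tt) * q (inl tt) + dot (fun v => p (inr v)) (fun v => q (inr v)).
  by rewrite /dot big_sumType /= (bigD1 tt) //= big1 ?addr0 // => -[].
have [hc|] := EM (forall z, (forall i, i \in index_enum ({set V} + V)%type ->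
    dot (a i) z <= 0) -> dot c z <= 0).
  exfalso; apply: ndom.
  have [l l0 lE] := farkas (index_enum_uniq _) hc.
  exists (fun A => l (inl A)); split=> [//||v].
    have := lE (inl tt); rewrite /= big_sumType /= [X in _ + X]big1 ?addr0.
      move=> ->; rewrite big_mkcond; apply: eq_bigr => A _.
      by case: (A \in F); rewrite ?mulr1 ?mulr0.
    by move=> u _; rewrite mulr0.
  have := lE (inr v); rewrite /= big_sumType /= => ->.
  rewrite -[X in X <= _]addr0 lerD //; last first.
    by apply: sumr_ge0 => u _; rewrite mulr_ge0.
  rewrite big_mkcond; apply: ler_sum => A _.
  by case: (A \in F); rewrite ?mul1r ?mul0r ?mulr0.
move=> /existsNP[z /not_implyP[hz /negP]]; rewrite -ltNge => cz.
have {}hz i : dot (a i) z <= 0 by apply: hz; rewrite mem_index_enum.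
pose s := z (inl tt); pose w0 v := - z (inr v).
have w0_ge0 v : 0 <= w0 v.
  have := hz (inr v); rewrite dot_opt /= mul0r add0r /dot (bigD1 v) //= eqxx.
  rewrite big1 ?addr0 ?mul1r /w0; first by lra.
  by move=> u; rewrite eq_sym => /negPf ->; rewrite mul0r.
have dotw0 (p : V -> R) : dot p (fun v => z (inr v)) = - dot p w0.
  by rewrite /dot -sumrN; apply: eq_bigr => v _; rewrite mulrN opprK.
have cE : dot c z = s - dot x w0 by rewrite dot_opt mul1r dotw0.
have s0 : 0 < s.
  have : 0 <= dot x w0 by apply: sumr_ge0 => v _; rewrite mulr_ge0.
  by rewrite cE in cz; lra.
pose w v := w0 v / s.
have dotw (p : V -> R) : dot p w = dot p w0 / s.
  by rewrite /dot mulr_suml; apply: eq_bigr => v _; rewrite mulrA.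
exists w; split=> [v|A AF|]; first by rewrite divr_ge0 // ltW.
  have := hz (inl A); rewrite dot_opt /= AF mul1r.
  have -> : (fun v => 1%:R * ind A v) = ind A by apply/funext=> v; rewrite mul1r.
  by rewrite dotw0 dotw ler_pdivlMr // mul1r -/s; lra.
by rewrite dotC dotw ltr_pdivrMr // mul1r; rewrite cE in cz; lra.
Qed.

Lemma cover_polyhedron_polyhedron C (w : {ffun V -> R}) :
  cover_polyhedron C w <->
  polyhedron (fun i : {set V} + V => match i with
                | inl A => if A \in C then ind A else fun=> 0
                | inr v => ind [set v]
                end)
             (fun i => if i is inl A then (A \in C)%:R else 0) w.
Proof.
split=> [[w0 wC] [A|v]|h].
- case: ifP => AC; first by rewrite dot_indl wC.
  by rewrite /dot big1 // => v _; rewrite mul0r.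
- by rewrite dot_indl big_set1.
split=> [v|A AC]; first by have := h (inr v); rewrite dot_indl big_set1.
by have := h (inl A); rewrite AC dot_indl.
Qed.

Lemma cover_polyhedron_vertex_le C x (w : {ffun V -> R}) :
    (forall v, 0 <= x v) -> cover_polyhedron C w ->
  exists2 w' : {ffun V -> R}, vertex (cover_polyhedron C) w'
    & dot x w' <= dot x w.
Proof.
move=> x0 /cover_polyhedron_polyhedron pw.
have [d v dv|w' [pw' ext] le] := ex_vertex_le _ x0 pw.
  by exists (inr v); rewrite dot_indl big_set1.
exists w' => //; split; first exact/cover_polyhedron_polyhedron.
by move=> y z t hy hz; apply: ext; apply/cover_polyhedron_polyhedron.
Qed.

Lemma mem_covers C B :
  reflect (forall A, A \in C -> A :&: B != set0) (B \in covers C).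
Proof. by rewrite inE; apply: (iffP forall_inP). Qed.

Lemma covers_dot_ge1 C A B :
  B \in covers C -> A \in C -> 1 <= dot (ind A) (ind B).
Proof. by move=> /mem_covers h /h; rewrite dot_ind ler1n card_gt0. Qed.

(** Otherwise a separating [w] lies in the cover polyhedron, and minimising [x] there gives an
    integral vertex [w'] with [dot x w' < 1]. The support of [w'] is a cover whose indicator is
    below [w'], so it violates the hypothesis on [x]. *)
Lemma ideal_dominant C x :
    ideal R C -> (forall v, 0 <= x v) ->
    (forall B, B \in covers C -> 1 <= dot (ind B) x) ->
  dominant C x.
Proof.
move=> idC x0 hx; apply: contrapT => /(not_dominant x0)[w [w0 wC wx]].
have cw : cover_polyhedron C (finfun w).
  split=> [v|A AC]; first by rewrite ffunE.
  by under eq_bigr do rewrite ffunE; rewrite -dot_indl wC.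
have [w' vw' le] := cover_polyhedron_vertex_le x0 cw.
have [[w'0 w'C] _] := vw'.
pose B := [set v | w' v != 0].
have w'B v : ind B v <= w' v.
  rewrite /ind inE; case: eqP => [->//|/eqP nz] /=.
  have /natrP[n e] : w' v \is a Num.nat.
    by rewrite Num.Theory.natrEint idC ?w'0.
  by rewrite e ler1n lt0n; apply: contra nz; rewrite e => /eqP->.
have : 1 <= dot (ind B) x.
  apply: hx; apply/mem_covers => A AC; apply/set0Pn.
  apply: contrapT => /forallNP h.
  have := w'C _ AC; rewrite big1 ?ler10 // => v vA.
  by apply/eqP/negPn/negP => nz; apply: (h v); rewrite !inE vA nz.
have : dot x w' < 1.
  apply: le_lt_trans le _; rewrite dotC; apply: le_lt_trans wx.
  by apply: ler_sum => v _; rewrite ffunE.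
by have := ler_dotr x0 w'B; rewrite (dotC x (ind B)); lra.
Qed.

(** If the cover [B] has positive weight, then [w] is a proper convex combination of [ind B] and a
    second point [q] of the polyhedron, so extremality forces [w = ind B]. *)
Lemma vertex_dominant_int C (w : {ffun V -> R}) :
    vertex (cover_polyhedron C) w -> dominant (covers C) w ->
  forall v, w v \is a Num.int.
Proof.
move=> [[w0 wC] ext] [y [y0 y1 yw]].
have [B BC yB] : exists2 B, B \in covers C & 0 < y B.
  apply: contrapT => /forall2NP h; have := y1; rewrite big1 => [|B BC].
    by move/esym/eqP; rewrite oner_eq0.
  have [//|/negP] := h B; rewrite -leNgt => le0.
  by apply/le_anti; rewrite le0 y0.
(* Halving keeps [t < 1] even when [B] carries all the weight. *)
pose t := y B / 2.
have yB1 : y B <= 1.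
  by rewrite -y1 (bigD1 B) //= lerDl sumr_ge0.
have t0 : 0 < t by rewrite divr_gt0.
have t1 : t < 1 by rewrite /t; lra.
have t1' : 1 - t != 0 by apply/eqP; lra.
pose q := [ffun v => (w v - t * ind B v) / (1 - t)].
have yBw v : y B * ind B v <= w v.
  apply: le_trans (yw v); rewrite (bigD1 B) //= lerDl sumr_ge0 // => B' _.
  by rewrite mulr_ge0 ?ind_ge0.
have wA A : A \in C -> y B * dot (ind A) (ind B) + (1 - y B) <= dot (ind A) w.
  move=> AC; apply: le_trans (dominant_dot (ind_ge0 A) yw).
  rewrite (bigD1 B) //= dotC lerD2l -y1 (bigD1 B BC) /= [X in X - _]addrC addrK.
  apply: ler_sum => B' /andP[B'C _].
  by rewrite ler_peMr // dotC (covers_dot_ge1 B'C).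
have -> : w = [ffun v => ind B v]; last first.
  by move=> v; rewrite ffunE /ind natr_int.
have e : [ffun v => ind B v] = q.
  apply: (ext _ _ t); rewrite ?t0 //.
  - split=> [v|A AC]; first by rewrite ffunE ind_ge0.
    by under eq_bigr do rewrite ffunE; rewrite -dot_indl (covers_dot_ge1 BC).
  - split=> [v|A AC].
      rewrite ffunE divr_ge0 ?subr_ge0 ?(ltW t1) //; apply: le_trans (yBw v).
      by apply: ler_wpM2r; rewrite ?ind_ge0 // /t; have := y0 B; lra.
    rewrite -dot_indl; pose q' v := w v + (- t) * ind B v.
    have -> : dot (ind A) q = dot (ind A) q' / (1 - t).
      rewrite /dot mulr_suml; apply: eq_bigr => v _.
      by rewrite ffunE /q' mulrA mulNr.
    rewrite (@dot_linr _ _ _ w (ind B) q' (- t)) //.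
    rewrite ler_pdivlMr; last lra.
    have := wA _ AC; have := covers_dot_ge1 BC AC; rewrite /t; set p := dot _ (ind B).
    by move: (y0 B); nra.
  by move=> v; rewrite !ffunE; field.
apply/ffunP=> v; have := congr1 (fun f : {ffun V -> R} => f v) e.
rewrite !ffunE => e'; have : ind B v * (1 - t) = w v - t * ind B v.
  by rewrite {1}e' divfK.
lra.
Qed.

End Dominant.

(** * Minimal points satisfying the cover inequalities *)

Section Tightening.
Variables (R : realType) (V : finType) (F : {set {set V}}).
Implicit Types (x : V -> R) (B : {set V}).

Lemma dot_ind_set1 B v : dot (ind R B) (ind R [set v]) = ind R B v.
Proof. by rewrite dotC dot_indl big_set1. Qed.

Lemma dot_indD1 B x v :
  v \in B -> dot (ind R B) x = x v + dot (ind R (B :\ v)) x.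
Proof.
move=> vB; rewrite !dot_indl (bigD1 v) //=; congr (_ + _).
by apply: eq_bigl => u; rewrite !inE andbC.
Qed.

Lemma dot_ind_ge0 B x : (forall v, 0 <= x v) -> 0 <= dot (ind R B) x.
Proof. by move=> x0; rewrite dot_indl sumr_ge0. Qed.

Lemma dot_indU B B' x :
  (forall v, 0 <= x v) ->
  dot (ind R (B :|: B')) x <= dot (ind R B) x + dot (ind R B') x.
Proof.
move=> x0; rewrite -big_split; apply: ler_sum => v _.
rewrite /= -mulrDl ler_wpM2r // /ind -natrD ler_nat inE.
by do 2!case: (v \in _).
Qed.

Definition tight x (v : V) :=
  (x v == 0) || [exists B in F, (v \in B) && (dot (ind R B) x == 1)].

(** [m] is the largest amount by which coordinate [v] can be lowered; the final disjunction names
    the constraint that blocks further decrease. *)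
Lemma tighten_at x v :
    (forall u, 0 <= x u) -> (forall B, B \in F -> 1 <= dot (ind R B) x) ->
  exists m, [/\ 0 <= m, m <= x v,
    forall B, B \in F -> v \in B -> m <= dot (ind R B) x - 1 &
    m = x v \/ exists B, [/\ B \in F, v \in B & m = dot (ind R B) x - 1]].
Proof.
move=> x0 hx.
have [B0 B0F|noB] := pickP (fun B => (B \in F) && (v \in B)); last first.
  exists (x v); split=> // [B BF vB|]; last by left.
  by have := noB B; rewrite BF vB.
pose s B := dot (ind R B) x - 1.
have [B /andP[BF vB] Bmin] :=
  @ex_minimizer _ _ (fun B => (B \in F) && (v \in B)) s _ B0F.
have [le|lt] := leP (x v) (s B).
  exists (x v); split=> // [B' B'F vB'|]; last by left.
  by apply: le_trans le _; apply: Bmin; rewrite B'F.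
exists (s B); split=> // [|||]; first by rewrite subr_ge0 hx.
- exact: ltW.
- by move=> B' B'F vB'; apply: Bmin; rewrite B'F.
by right; exists B.
Qed.

(** Lowering a coordinate that is not tight as far as possible makes it tight and spoils no other: a
    tight set through [v] would already have made [v] tight. The number of coordinates that are not
    tight therefore drops. *)
Lemma ex_tight x :
    (forall v, 0 <= x v) -> (forall B, B \in F -> 1 <= dot (ind R B) x) ->
  exists x', [/\ forall v, 0 <= x' v, forall v, x' v <= x v,
    forall B, B \in F -> 1 <= dot (ind R B) x' & forall v, tight x' v].
Proof.
have [n] := ubnP #|[set v | ~~ tight x v]|; elim: n x => // n IH x ltn x0 hx.
have [v /= ntv|allt] := pickP (fun v => ~~ tight x v); last first.
  by exists x; split=> // v; apply/negPn; rewrite allt.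
have [m [m0 mx mB mE]] := tighten_at v x0 hx.
pose x1 u := x u + (- m) * ind R [set v] u.
have dotx1 B : dot (ind R B) x1 = dot (ind R B) x - m * ind R B v.
  by rewrite (@dot_linr _ _ _ x (ind R [set v]) x1 (- m)) // dot_ind_set1 mulNr.
have x1v : x1 v = x v - m by rewrite /x1 /ind set11 mulr1.
have x1u u : u != v -> x1 u = x u.
  by move=> /negPf uv; rewrite /x1 /ind inE uv mulr0 addr0.
have x1_le u : x1 u <= x u.
  by have [->|/x1u->//] := eqVneq u v; rewrite x1v gerBl.
have tv : tight x1 v.
  rewrite /tight; have [e|[B [BF vB e]]] := mE; first by rewrite x1v e subrr eqxx.
  apply/orP; right; apply/existsP; exists B; rewrite BF vB /= dotx1.
  by rewrite /ind vB mulr1 e; apply/eqP; ring.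
have tx1 u : tight x u -> tight x1 u.
  have [->//|uv] := eqVneq u v; rewrite {2}/tight x1u //.
  move=> /orP[->//|/existsP[B /and3P[BF uB tB]]].
  apply/orP; right; apply/existsP; exists B; rewrite BF uB /= dotx1.
  rewrite /ind; case: (boolP (v \in B)) => vB; last by rewrite mulr0 subr0.
  case/negP: ntv; apply/orP; right; apply/existsP; exists B.
  by rewrite BF vB.
have [||B BF|x' [x'0 x'_le hx' tx']] := IH x1.
- rewrite -ltnS; apply: leq_trans ltn; rewrite ltnS; apply: proper_card; apply/properP; split.
    by apply/subsetP => u; rewrite !inE; apply/contra/tx1.
  by exists v; rewrite !inE // tv.
- move=> u; have [->|/x1u->//] := eqVneq u v.
  by rewrite x1v subr_ge0.
- rewrite dotx1 /ind; case: (boolP (v \in B)) => vB; last first.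
    by rewrite mulr0 subr0 hx.
  by rewrite mulr1; have := mB _ BF vB; lra.
by exists x'; split=> // v'; apply: le_trans (x'_le _) (x1_le _).
Qed.

End Tightening.

(** * The core of a 2-cover-minimal clutter and its idealness *)

Section TwoCover.
Variables (R : realType) (V : finType) (C : {set {set V}}).
Implicit Types (A B : {set V}) (x : V -> R).
Hypothesis (hmin : two_cover_minimal C).

Lemma min_sizeP (F : {set {set V}}) m :
  min_size F = Some m ->
  (exists2 B, B \in F & #|B| = m) /\ (forall B, B \in F -> (m <= #|B|)%N).
Proof.
rewrite /min_size; case: pickP => // B0 B0F [<-].
by case: arg_minnP => // B BF Bmin; split=> //; exists B.
Qed.

Lemma covers_card_ge2 B : B \in covers C -> (2 <= #|B|)%N.
Proof. by have [/min_sizeP[_ h] _] := hmin; exact: h. Qed.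

Lemma mem_min_covers B : (B \in min_covers C) = (B \in covers C) && (#|B| == 2%N).
Proof.
have [/min_sizeP[[B0 B0C B02] h] _] := hmin.
rewrite inE; case BC: (B \in covers C) => //=.
apply/forall_inP/eqP => [le|-> //].
by apply/eqP; rewrite eqn_leq h // -B02 le.
Qed.

Lemma min_coverP B :
  B \in min_covers C -> exists u v, [/\ u != v, B = [set u; v] & cover_graph C u v].
Proof.
move=> Bm; have := Bm; rewrite mem_min_covers => /andP[_ /cards2P[u [v [uv BE]]]].
by exists u, v; split=> //; rewrite /cover_graph uv -BE.
Qed.

Lemma cover_graph_sym : symmetric (cover_graph C).
Proof. by move=> u v; rewrite /cover_graph eq_sym setUC. Qed.

Lemma ex_neighbour v : exists u, cover_graph C v u.
Proof.
have [_ /(_ v)[B /min_coverP[u [w [uw -> e]]]]] := hmin.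
rewrite !inE => /orP[/eqP->|/eqP->]; first by exists w.
by exists u; rewrite cover_graph_sym.
Qed.

Lemma dot_ind2 u v x : u != v -> dot (ind R [set u; v]) x = x u + x v.
Proof.
move=> uv; rewrite (@dot_indD1 _ _ _ _ u) ?set21 // dot_indl; congr (_ + _).
rewrite -[RHS](big_set1 (GRing.add : Monoid.law 0)); apply: eq_bigl => w.
by rewrite !inE; case: (eqVneq w u) => //= ->; rewrite (negPf uv).
Qed.

(** Thus a core member is one side of a 2-colouring of each component of the graph, which makes it a
    point of the cube. *)
Lemma core_edge A u v :
  A \in core C -> cover_graph C u v -> (v \in A) = ~~ (u \in A).
Proof.
rewrite inE => /andP[_ /forall_inP h] /andP[uv /h /eqP card1].
have S0 : A :&: [set u; v] :\ u :\ v = set0.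
  by apply/setP => w; rewrite !inE; case: (w == u); case: (w == v); rewrite ?andbF.
move: card1; rewrite (cardsD1 u) (cardsD1 v) S0 cards0 !inE !eqxx (eq_sym v) uv orbT.
by case: (u \in A); case: (v \in A).
Qed.

Lemma core_sub : core C \subset C.
Proof. by apply/subsetP => A; rewrite inE => /andP[]. Qed.

Lemma covers_core B : B \in covers C -> B \in covers (core C).
Proof.
move=> /mem_covers h; apply/mem_covers => A Ac.
by apply: h; apply: (subsetP core_sub).
Qed.

Hypothesis hideal : ideal R C.

(* Complementary slackness: the multipliers live on the core. *)
Lemma core_dominant x :
    (forall v, 0 <= x v) ->
    (forall B, B \in covers C -> 1 <= dot (ind R B) x) ->
    (forall u v, cover_graph C u v -> x u + x v = 1) ->
  dominant (core C) x.
Proof.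
move=> x0 hx xe; have [y [y0 y1 yx]] := ideal_dominant hideal x0 hx.
have y_core A : A \in C -> A \notin core C -> y A = 0.
  move=> hA; rewrite inE hA /= => /forall_inPn [B Bm AB].
  have := Bm; rewrite mem_min_covers => /andP[Bc _].
  have ge1 A' : A' \in C -> 0 <= y A' * (dot (ind R A') (ind R B) - 1).
    by move=> A'C; rewrite mulr_ge0 // subr_ge0 (covers_dot_ge1 _ Bc).
  (* These terms are nonnegative and their sum is at most [dot (ind R B) x - 1], which is 0 because
     [B] is an edge. *)
  have : \sum_(A' in C) y A' * (dot (ind R A') (ind R B) - 1) = 0.
    apply/le_anti; rewrite sumr_ge0 // andbT.
    under eq_bigr do rewrite mulrBr mulr1; rewrite sumrB y1 subr_le0.
    apply: le_trans (dominant_dot (ind_ge0 R B) yx) _.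
    by have [u [v [uv -> e]]] := min_coverP Bm; rewrite dot_ind2 // xe.
  move=> /(psumr_eq0P ge1)/(_ _ hA)/eqP; rewrite mulf_eq0 => /orP[/eqP//|].
  by rewrite dot_ind subr_eq0 pnatr_eq1 (negPf AB).
have sum_core (f : {set V} -> R) :
    \sum_(A in core C) y A * f A = \sum_(A in C) y A * f A.
  rewrite big_mkcond [RHS]big_mkcond; apply: eq_bigr => A _.
  case: (boolP (A \in core C)) => [/(subsetP core_sub)->//|nA].
  by case: ifP => // hA; rewrite y_core // mul0r.
exists y; split=> // [|v]; last by rewrite sum_core.
by rewrite -y1; have := sum_core (fun=> 1); under eq_bigr do rewrite mulr1;
  under [in RHS]eq_bigr do rewrite mulr1.
Qed.

(* If an edge were slack, resolving the two tight covers through its ends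
   would give a violated cover of the core. *)
Lemma tight_edge x u v :
    (forall v, 0 <= x v) ->
    (forall B, B \in covers (core C) -> 1 <= dot (ind R B) x) ->
    (forall v, tight (covers (core C)) x v) ->
    cover_graph C u v -> x u + x v = 1.
Proof.
move=> x0 hx tx uv; have [neq_uv edge_uv] := andP uv.
have edge_ge : 1 <= x u + x v.
  rewrite -dot_ind2 //; apply/hx/covers_core.
  by move: edge_uv; rewrite mem_min_covers => /andP[].
have le_dot B w : w \in B -> x w <= dot (ind R B) x.
  by move=> wB; rewrite (dot_indD1 _ wB) lerDl dot_ind_ge0.
have tightP w : x w = 0 \/
    exists B, [/\ B \in covers (core C), w \in B & dot (ind R B) x = 1].
  have /orP[/eqP|/existsP[B /and3P[Bc wB /eqP dB]]] := tx w; first by left.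
  by right; exists B.
have le1 w : x w <= 1.
  by have [->//|[B [_ wB <-]]] := tightP w; exact: le_dot.
have [xu|[B1 [B1c uB1 dB1]]] := tightP u; first by have := le1 v; lra.
have [xv|[B2 [B2c vB2 dB2]]] := tightP v; first by have := le1 u; lra.
have : 1 <= dot (ind R (B1 :\ u :|: B2 :\ v)) x.
  (* A core member contains exactly one of [u], [v], so it meets the tight cover of the missing end
     outside that end. *)
  apply: hx; apply/mem_covers => A Ac.
  have vA := core_edge Ac uv.
  case: (boolP (u \in A)) => uA; rewrite uA in vA.
    have /set0Pn[w] := mem_covers _ _ B2c _ Ac; rewrite inE => /andP[wA wB].
    apply/set0Pn; exists w; rewrite !inE wA wB andbT.
    by apply/orP; right; apply: contraTneq wA => ->; rewrite vA.
  have /set0Pn[w] := mem_covers _ _ B1c _ Ac; rewrite inE => /andP[wA wB].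
  apply/set0Pn; exists w; rewrite !inE wA wB andbT.
  by apply/orP; left; apply: contraTneq wA => ->.
have := dot_indU (B1 :\ u) (B2 :\ v) x0.
have := dot_indD1 x uB1; have := dot_indD1 x vB2; lra.
Qed.

Lemma core_ideal : ideal R (core C).
Proof.
move=> w vw; apply: (vertex_dominant_int vw); have [[w0 wC] _] := vw.
apply: contrapT => /(not_dominant w0)[x [x0 xB xw]].
have [x' [x'0 x'x x'B tx']] := ex_tight x0 xB.
have dx' : dominant (core C) x'.
  apply: core_dominant => // [B /covers_core/x'B//|u v].
  exact: tight_edge.
have : 1 <= dot w x'.
  by apply: dominant_dot_ge dx' _ => // A Ac; rewrite dot_indl wC.
have := ler_dotr w0 x'x; rewrite (dotC w x); lra.
Qed.

End TwoCover.

(** * Covering codes in the Hamming cube and the entropy bound *)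

Section CoveringCode.
Variables (R : realType) (T : finType) (X : {set T}).
Implicit Types A P : {set T}.

Definition dist A P := #|[set r in X | (r \in A) != (r \in P)]|.

(** The terms of the expanded product are indexed by sets [P]: [f r] is the factor when [r] is in
    [P], [g r] when it is not. Since [f] vanishes off [X], subsets of [X] give exactly the left
    side. *)
Lemma sum_dist_le A (rho : R) :
  0 <= rho -> \sum_(P in powerset X) rho ^+ dist A P <= (1 + rho) ^+ #|X|.
Proof.
move=> rho0.
pose f r : R := if r \in X then (if r \in A then 1 else rho) else 0.
pose g r : R := if r \in X then (if r \in A then rho else 1) else 1.
have -> : (1 + rho) ^+ #|X| = \prod_r (f r + g r).
  rewrite -prodr_const big_mkcond; apply: eq_bigr => r _.
  by rewrite /f /g; case: (r \in X); [case: (r \in A)|]; rewrite ?add0r // addrC.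
rewrite bigA_distr big_mkcond; apply: ler_sum => P _.
case: ifP => [|_]; last first.
  by apply: prodr_ge0 => r _; rewrite /f /g; do ![case: ifP => _ //].
rewrite powersetE => /subsetP PX.
rewrite -prodr_const big_mkcond le_eqVlt; apply/orP; left; apply/eqP.
apply: eq_bigr => r _; rewrite inE /f /g.
have := PX r; case: (r \in P) => [->//|_]; last first.
  by case: (r \in X); case: (r \in A).
by case: (r \in A).
Qed.

(** Double counting of [rho ^+ dist A P] over all pairs: each [P] receives at least [c], and each
    [A] gives at most [(1 + rho) ^+ #|X|]. This weighted count replaces an estimate of ball
    sizes. *)
Lemma covering_code_bound (S : {set {set T}}) (rho c : R) :
    0 <= rho ->
    (forall P, P \subset X -> exists2 A, A \in S & c <= rho ^+ dist A P) ->
  2 ^+ #|X| * c <= #|S|%:R * (1 + rho) ^+ #|X|.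
Proof.
move=> rho0 cov.
have -> : 2 ^+ #|X| * c = \sum_(P in powerset X) c.
  by rewrite sumr_const card_powerset -[RHS]mulr_natl natrX.
have -> : #|S|%:R * (1 + rho) ^+ #|X| = \sum_(A in S) (1 + rho) ^+ #|X|.
  by rewrite sumr_const mulr_natl.
apply: (@le_trans _ _ (\sum_(P in powerset X) \sum_(A in S) rho ^+ dist A P)).
  apply: ler_sum => P; rewrite powersetE => /cov[A AS le].
  apply: le_trans le _; rewrite (bigD1 A) //= lerDl.
  by apply: sumr_ge0 => *; rewrite exprn_ge0.
by rewrite exchange_big; apply: ler_sum => A _; exact: sum_dist_le.
Qed.

(** With [e = 1/m] and [rho = e/(1-e)] one has [1 + rho = 1/(1-e)], and
    [rho^e (1-e) = e^e (1-e)^(1-e)] is [2^(-H(e))]. *)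
Lemma entropy_bound (m d s : nat) :
    (1 < m)%N ->
    2 ^+ d * ((1 / m%:R) / (1 - 1 / m%:R)) `^ (1 / m%:R * d%:R)
      <= s%:R * (1 + (1 / m%:R) / (1 - 1 / m%:R)) ^+ d :> R ->
  2 `^ ((1 - H (1 / m%:R)) * d%:R) <= s%:R :> R.
Proof.
move=> m1; set e : R := 1 / m%:R.
have e0 : 0 < e by rewrite divr_gt0 // ltr0n ltnW.
have e1 : e < 1 by rewrite /e ltr_pdivrMr ?mul1r ?ltr1n // ltr0n ltnW.
have e1' : 0 < 1 - e by rewrite subr_gt0.
have -> : 1 + e / (1 - e) = (1 - e)^-1 by field; rewrite gt_eqF.
have ln2 : ln 2 != 0 :> R by rewrite gt_eqF // ln_gt0 // ltr1n.
rewrite exprVn ler_pdivlMr ?exprn_gt0 //; apply: le_trans.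
rewrite le_eqVlt; apply/orP; left; apply/eqP.
have expE (a : R) : 0 < a -> a ^+ d = expR (d%:R * ln a).
  by move=> a0; rewrite -powR_mulrn ?ltW // /powR gt_eqF.
rewrite !expE // /powR !gt_eqF ?(divr_gt0 e0 e1') // -!expRD; congr expR.
rewrite lnM ?posrE ?invr_gt0 // lnV ?posrE //.
by rewrite /H gt_eqF // /log2; field.
Qed.

End CoveringCode.

(** * The core as a covering code of the cube *)

Section RainbowBound.
Variables (R : realType) (V : finType) (C : {set {set V}}).
Implicit Types (A B P : {set V}) (x : V -> R).
Hypotheses (hmin : two_cover_minimal C) (hideal : ideal R C).

Let rt := fingraph.root (cover_graph C).
(** One representative per component: these are the coordinates of the cube. *)
Let X := [set rt v | v in V].

Let csym : connect_sym (cover_graph C).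
Proof. exact/sym_connect_sym/cover_graph_sym. Qed.

Lemma root_rep r : r \in X -> rt r = r.
Proof. by move=> /imsetP[v _ ->]; rewrite /rt root_root. Qed.

Lemma card_components : #|components C| = #|X|.
Proof.
have -> : components C = [set [set v in [set: V] | connect (cover_graph C) r v] | r in X].
  apply/setP => K; apply/imsetP/imsetP => [[u _ ->]|[r rX ->]]; last by exists r.
  exists (rt u); first exact: imset_f.
  apply/setP => v; rewrite !inE /=; apply: (same_connect csym); exact: connect_root.
apply: card_in_imset => r s /root_rep rr /root_rep ss /setP/(_ s).
by rewrite !inE connect0 -root_connect // -/(rt r) -/(rt s) rr ss => /eqP.
Qed.

Lemma component_connect K u v :
  K \in components C -> u \in K -> v \in K -> connect (cover_graph C) u v.
Proof.
move=> /imsetP[r _ ->]; rewrite !inE /= => ru rv.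
by apply: connect_trans rv; rewrite csym.
Qed.

(** The centre of the cube satisfies all cover inequalities because covers have at least two
    elements; hence the core is nonempty. *)
Lemma half_dominant : dominant (core C) (fun=> 2^-1 : R).
Proof.
apply: core_dominant => // [v|B Bc|u v _]; rewrite ?invr_ge0 //; last by lra.
rewrite dot_indl sumr_const -mulr_natr.
by have := covers_card_ge2 hmin Bc; rewrite -(ler_nat R); lra.
Qed.

Lemma core_nonempty : exists A, A \in core C.
Proof.
apply/set0Pn; have [y [_ + _]] := half_dominant.
by apply: contra_eq_neq => ->; rewrite big_set0 eq_sym oner_neq0.
Qed.

Lemma core_connect A A' u v :
    A \in core C -> A' \in core C -> connect (cover_graph C) u v ->
  (u \in A) (+) (u \in A') = (v \in A) (+) (v \in A').
Proof.
move=> Ac A'c /connectP[p + ->]; elim: p u => //= w p IH u /andP[uw /IH <-].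
rewrite (core_edge Ac uw) (core_edge A'c uw).
by case: (_ \in A); case: (_ \in A').
Qed.

Section Point.
Variables (A0 P : {set V}) (e : R).
Hypotheses (A0c : A0 \in core C) (e0 : 0 <= e).
(** Satisfied by [e = 1/mu], and by [e = 0] when there is no rainbow cover. *)
Hypothesis he : forall B, B \in rainbow_covers C -> 1 <= e * #|B|%:R.
Hypothesis e_half : e <= 1 - e.

(* The union of colour classes, one in each component, that agrees with [P]
   on the representatives. *)
Definition side v := (v \in A0) (+) (rt v \in A0) (+) (rt v \in P).

Definition side_point v : R := if side v then 1 - e else e.

(** On each component [side] is [A0] up to a constant flip, so this reduces to [core_connect]. *)
Lemma side_connect A u v :
    A \in core C -> connect (cover_graph C) u v ->
  (u \in A) (+) side u = (v \in A) (+) side v.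
Proof.
move=> Ac uv; have := core_connect Ac A0c uv.
rewrite /side; have -> : rt v = rt u.
  by apply/esym/eqP; rewrite /rt root_connect.
case: (u \in A); case: (v \in A); case: (u \in A0); case: (v \in A0);
  by case: (rt u \in A0); case: (rt u \in P).
Qed.

Lemma side_point_opp u v : side u != side v -> side_point u + side_point v = 1.
Proof. by rewrite /side_point; case: (side u); case: (side v) => //= _; lra. Qed.

Lemma side_edge u v : cover_graph C u v -> side v = ~~ side u.
Proof.
move=> uv; have := side_connect A0c (connect1 uv).
rewrite (core_edge A0c uv).
by case: (_ \in _); case: (side u); case: (side v).
Qed.

Lemma side_point_edge u v :
  cover_graph C u v -> side_point u + side_point v = 1.
Proof. by move=> /side_edge h; rewrite side_point_opp // h; case: (side u). Qed.

Lemma side_point_ge v : e <= side_point v.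
Proof. by rewrite /side_point; case: ifP. Qed.

Lemma side_point_ge0 v : 0 <= side_point v.
Proof. exact: le_trans (side_point_ge v). Qed.

(* On the segment from the centre [1/2] to [side_point], look at the first
   cover [B] that becomes tight before being violated. It is not rainbow and
   contains two elements of one colour class, so that one of them is redundant
   for covering the core; but the point lies in the convex hull of the core. *)
Lemma side_point_covers B : B \in covers C -> 1 <= dot (ind R B) side_point.
Proof.
move=> BC0; rewrite leNgt; apply/negP => Bbad0.
pose x := side_point.
pose bad B := (B \in covers C) && (dot (ind R B) x < 1).
pose h B : R := #|B|%:R / 2.
(* The parameter at which the segment from the centre to [x] meets the hyperplane of [B]. *)
pose lam B := (h B - 1) / (h B - dot (ind R B) x).
have hE B' : dot (ind R B') (fun=> 2^-1 : R) = h B'.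
  by rewrite dot_indl sumr_const -[LHS]mulr_natl.
have h1 B' : B' \in covers C -> 1 <= h B'.
  move=> B'c; rewrite /h; have := covers_card_ge2 hmin B'c.
  by rewrite -(ler_nat R); lra.
have badB : bad B by rewrite /bad BC0.
have [{badB BC0 Bbad0}B /andP[Bc Bbad] Bmin] := @ex_minimizer _ _ bad lam B badB.
have min_dot B' : B' \in min_covers C -> dot (ind R B') x = 1.
  move=> /(min_coverP hmin)[u [v [uv -> uve]]].
  by rewrite dot_ind2 // side_point_edge.
have hB : 1 < h B.
  have : (2 < #|B|)%N.
    rewrite ltn_neqAle (covers_card_ge2 hmin Bc) andbT eq_sym; apply/negP => B2.
    have Bm : B \in min_covers C by rewrite mem_min_covers // Bc.
    by rewrite min_dot // ltxx in Bbad.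
  by rewrite /h -(ltr_nat R); lra.
pose l := lam B.
have den : 0 < h B - dot (ind R B) x by lra.
have l0 : 0 < l by rewrite divr_gt0 // subr_gt0.
have l1 : l < 1 by rewrite ltr_pdivrMr // mul1r; lra.
pose q v := 2^-1 + l * (x v + (-1) * 2^-1).
have qE B' : dot (ind R B') q = h B' + l * (dot (ind R B') x - h B').
  rewrite (@dot_linr _ _ _ (fun=> 2^-1) (fun v => x v + (-1) * 2^-1) q l) //.
  rewrite (@dot_linr _ _ _ x (fun=> 2^-1) (fun v => x v + (-1) * 2^-1) (-1)) //.
  by rewrite hE mulN1r.
(* Strict because [l < 1]; deleting an element of [B] therefore drops below 1 at the end. *)
have q_gt0 v : 0 < q v.
  have := side_point_ge0 v; rewrite -/(x v) /q; nra.
have qdom : dominant (core C) q.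
  apply: core_dominant => // [v|B' B'c|u v uv]; first exact: ltW.
    rewrite qE; have h1B' := h1 _ B'c; have [ge1|lt1] := leP 1 (dot (ind R B') x).
      by nra.
    have : l <= lam B' by apply: Bmin; rewrite /bad B'c.
    rewrite /lam ler_pdivlMr; lra.
  have := side_point_edge uv; rewrite -/(x u) -/(x v) /q; nra.
have qB : dot (ind R B) q = 1.
  by rewrite qE /l /lam; field; rewrite gt_eqF.
have [K KC [u [v [uB vB uK vK uv]]]] : exists2 K, K \in components C &
    exists u v, [/\ u \in B, v \in B, u \in K, v \in K & u != v].
  have : B \notin rainbow_covers C.
    apply/negP => /he; rewrite leNgt => /negP; apply.
    apply: le_lt_trans Bbad; rewrite dot_indl mulr_natr -sumr_const.
    by apply: ler_sum => v _; exact: side_point_ge.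
  rewrite inE Bc /= => /forall_inPn[K KC]; rewrite -ltnNge => /card_gt1P.
  case=> u [v [+ + uv]]; rewrite !inE => /andP[uB uK] /andP[vB vK].
  by exists K => //; exists u, v.
have conn := component_connect KC uK vK.
(* Elements on opposite sides would already contribute 1, and [B] would not be violated. *)
have same : side u = side v.
  apply/eqP/negPn/negP => /side_point_opp; rewrite -/(x u) -/(x v) => xuv.
  move: Bbad; rewrite (dot_indD1 x uB) (@dot_indD1 _ _ _ _ v).
    have := dot_ind_ge0 (B :\ u :\ v) side_point_ge0; rewrite -/x; lra.
  by rewrite !inE eq_sym uv vB.
(* A core member containing [u] also contains [v], so [B :\ u] still covers the core. *)
have cov : 1 <= dot (ind R (B :\ u)) q.
  apply: dominant_dot_ge qdom _ => [w|A Ac]; first exact: ind_ge0.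
  rewrite dot_ind ler1n card_gt0; apply/set0Pn.
  have /set0Pn[w] := mem_covers _ _ Bc _ (subsetP (core_sub C) _ Ac).
  rewrite inE => /andP[wA wB]; have [wu|wu] := eqVneq w u; last first.
    by exists w; rewrite !inE wA wu.
  exists v; rewrite !inE eq_sym uv vB /=.
  have := side_connect Ac conn; rewrite same -wu wA.
  by case: (v \in A); case: (side v).
by have := q_gt0 u; move: qB; rewrite (dot_indD1 q uB); lra.
Qed.

(** The minimum distance is at most its average under the convex weights of [side_point], and each
    coordinate disagrees with [P] with weight at most [e]. *)
Lemma ex_core_near :
  exists2 A, A \in core C & (dist X A P)%:R <= e * #|X|%:R.
Proof.
have [||y [y0 y1 yx]] := @core_dominant _ _ _ hmin hideal side_point side_point_ge0.
- exact: side_point_covers.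
- exact: side_point_edge.
have [A Ac Amin] := @ex_minimizer R _ (fun A => A \in core C)
  (fun A => (dist X A P)%:R) _ A0c.
exists A => //.
apply: (@le_trans _ _ (\sum_(A in core C) y A * (dist X A P)%:R)).
  rewrite -[X in X <= _]mul1r -[X in X * _ <= _]y1 mulr_suml; apply: ler_sum => A' A'c.
  by rewrite ler_wpM2l // Amin.
have distE A' : (dist X A' P)%:R = \sum_(r in X) ((r \in A') != (r \in P))%:R :> R.
  rewrite /dist -sum1_card natr_sum big_mkcond [RHS]big_mkcond.
  by apply: eq_bigr => r _; rewrite inE; case: (r \in X); case: (_ != _).
under eq_bigr do rewrite distE mulr_sumr.
rewrite exchange_big mulr_natr -sumr_const; apply: ler_sum => r rX /=.
have sr : side r = (r \in P) by rewrite /side -/rt root_rep // addbb.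
have [u ru] := ex_neighbour hmin r.
case rP: (r \in P) sr => sr.
  (* Domination bounds only the weight of containing a point, so the weight of missing [r] is read
     off at its neighbour [u]. *)
  apply: (@le_trans _ _ (side_point u)); last first.
    by rewrite /side_point (side_edge ru) sr.
  apply: le_trans (yx u); apply: ler_sum => A' A'c.
  by rewrite /ind (core_edge A'c ru); case: (r \in A').
apply: (@le_trans _ _ (side_point r)); last by rewrite /side_point sr.
apply: le_trans (yx r); apply: ler_sum => A' A'c.
by rewrite /ind; case: (r \in A').
Qed.

End Point.

Lemma core_card_ge :
  2 `^ ((1 - H_inv R (rainbow_number C)) * #|components C|%:R)
    <= #|core C|%:R :> R.
Proof.
have [A0 A0c] := core_nonempty; rewrite card_components.
rewrite /rainbow_number; case E: (min_size _) => [m|] /=; last first.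
  have norb B : B \in rainbow_covers C -> 1 <= 0 * #|B|%:R :> R.
    move: E; rewrite /min_size; case: pickP => // none _ Br.
    by have := none B; rewrite Br.
  (* With [e = 0] every vertex is at distance 0 from the core; [rho = 0] works since
     [0 ^+ 0 = 1]. *)
  have : 2 ^+ #|X| * 1 <= #|core C|%:R * (1 + 0) ^+ #|X| :> R.
    apply: covering_code_bound => // P _.
    have [|||A Ac] := @ex_core_near A0 P 0 A0c; rewrite ?subr0 //.
    by rewrite mul0r lern0 => /eqP dist0; exists A; rewrite ?dist0.
  by rewrite subr0 mul1r powR_mulrn // addr0 expr1n !mulr1.
have [[B Br Bm] mle] := min_sizeP E.
have m2 : (1 < m)%N.
  rewrite -Bm; apply: covers_card_ge2 hmin _ _.
  by move: Br; rewrite inE => /andP[].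
have m0 : 0 < m%:R :> R by rewrite ltr0n ltnW.
have m2R : 2 <= m%:R :> R by rewrite ler_nat.
set e : R := 1 / m%:R.
have e0 : 0 < e by rewrite divr_gt0.
have e_half : e <= 2^-1 by rewrite ler_pdivrMr //; lra.
apply: entropy_bound => //; rewrite -/e; set rho := e / (1 - e).
have rho0 : 0 < rho by rewrite divr_gt0 //; lra.
(* This makes powers of [rho] decrease, turning the distance bound into a lower bound on
   [rho ^+ dist X A P]. *)
have rho1 : rho <= 1 by rewrite ler_pdivrMr; lra.
apply: covering_code_bound => [|P _]; first exact: ltW.
have [B' B'r||A Ac near] := @ex_core_near A0 P e A0c (ltW e0).
- by rewrite /e mul1r mulrC ler_pdivlMr // mul1r ler_nat mle.
- by lra.
exists A => //; rewrite -(powR_mulrn _ (ltW rho0)).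
rewrite /powR (gt_eqF rho0) ler_expR ler_wnM2r //.
by rewrite ln_le0.
Qed.

End RainbowBound.

Theorem theorem5p5 (R : realType) (V : finType) (C : {set {set V}})
    (hclutter : is_clutter C)
    (hideal : ideal R C)
    (hmin : two_cover_minimal C) :
  [/\ is_clutter (core C),
      ideal R (core C)
    & 2 `^ ((1 - H_inv R (rainbow_number C)) * #|components C|%:R)
        <= #|core C|%:R :> R].
Proof.
split; [|exact: core_ideal|exact: core_card_ge].
by move=> A B /(subsetP (core_sub C)) hA /(subsetP (core_sub C)); exact: hclutter.
Qed.
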